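(* Let $X, Y\subseteq\mathbb{C}$ be perfect compact sets and $(M_n)$ a weight sequence such that $D(X,M)$ and $D(Y,M)$ are good, and let $\phi:X\to Y$ be analytic. If $\sup_{z\in X}|\phi'(z)|<1$, then $\phi$ induces a compact homomorphism from $D(Y,M)$ into $D(X,M)$.
   Context: For a perfect compact plane set $X$, $f:X\to\mathbb{C}$ is complex-differentiable at $a\in X$ if $f'(a)=\lim_{z\to a,\ z\in X}\frac{f(z)-f(a)}{z-a}$ exists; $f^{(n)}$ denotes the $n$-th complex derivative in this sense (with $f^{(0)}=f$), and $D^\infty(X)$ is the set of infinitely complex-differentiable functions on $X$. A weight sequence is a sequence $(M_n)_{n\ge 0}$ of positive numbers with $M_0=1$ and $\frac{M_{n+m}}{M_nM_m}\ge\binom{n+m}{n}$ for all non-negative integers $m,n$. The Dales-Davie algebra is $$D(X,M)=\Big\{f\in D^\infty(X):\ \|f\|_D=\sum_{n=0}^\infty\frac{\|f^{(n)}\|_\infty}{M_n}<\infty\Big\},$$ where $\|\cdot\|_\infty$ is the supremum norm on $X$. A set $X$ is good if $D(X,M)$ is complete for all weight sequences $(M_n)$. The sequence $(M_n)$ is non-analytic if $\lim_{n\to\infty}(n!/M_n)^{1/n}=0$. $D(X,M)$ is natural if its maximal ideal space is precisely $X$ (every character is evaluation at a point of $X$). The algebra $D(X,M)$ is good if $X$ is good, $(M_n)$ is non-analytic and $D(X,M)$ is natural. A map $\phi\in D^\infty(X)$ is called analytic if $\sup_{k\ge1}\left(\|\phi^{(k)}\|_\infty/k!\right)^{1/k}<\infty$.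 A map $\phi:X\to Y$ induces a homomorphism $D(Y,M)\to D(X,M)$ if $f\circ\phi\in D(X,M)$ for every $f\in D(Y,M)$; the induced homomorphism is $f\mapsto f\circ\phi$, and it is called compact if it is a compact linear operator. *)

(* Defs.v *)
From HB Require Import structures.
From mathcomp Require Import all_boot all_order all_algebra.
From mathcomp Require Import complex ring.
From mathcomp Require Import all_classical all_reals all_analysis.

Set Implicit Arguments.
Unset Strict Implicit.
Unset Printing Implicit Defensive.
Import Order.TTheory GRing.Theory Num.Theory.
Import numFieldNormedType.Exports.
Import ComplexField.Normc.

Local Open Scope classical_set_scope.
Local Open Scope ring_scope.
Local Open Scope complex_scope.

(* The topology of the modulus; the library leaves R[i] without a topology. *)
HB.instance Definition _ (R : realType) := NormedModule.copy R[i] R[i]^o.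

Record perfect_compact (R : realType) := PerfectCompact {
  pc_set :> set R[i];
  pc_compact : compact pc_set;
  pc_perfect : perfect_set pc_set }.

Record weight_sequence (R : realType) := WeightSequence {
  weight :> nat -> R;
  weight_gt0 : forall n, 0 < weight n;
  weight0 : weight 0%N = 1;
  weight_binomial : forall m n,
    'C(n + m, n)%:R <= weight (n + m)%N / (weight m * weight n) }.

Section differentiation.
Context (R : realType) (X : set R[i]).

(* [X] is used as a type, with its subspace topology; hence [z --> a^'] ranges
   over the points of [X] other than [a]. *)
Definition diff_quot (f : X -> R[i]) (a z : X) : R[i] :=
  (f z - f a) / (set_val z - set_val a).

Definition cderivable (f : X -> R[i]) (a : X) : Prop :=
  cvg (diff_quot f a z @[z --> a^']).

(* The derivative when it exists and [a] is not isolated in [X]; otherwise an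
   unspecified value. *)
Definition cderive (f : X -> R[i]) (a : X) : R[i] :=
  lim (diff_quot f a z @[z --> a^']).

Definition cderiven (n : nat) (f : X -> R[i]) : X -> R[i] := iter n cderive f.

Definition smooth (f : X -> R[i]) : Prop :=
  forall n a, cderivable (cderiven n f) a.

(* A real supremum: by junk-value convention it is 0 when [f] is unbounded or [X]
   is empty.  Each derivative of a smooth function on a compact [X] is
   continuous, hence bounded (see [normc_le_supnorm]). *)
Definition supnorm (f : X -> R[i]) : R := sup [set normc (f x) | x in setT].

Definition dnorm (M : nat -> R) (f : X -> R[i]) : \bar R :=
  (\sum_(0 <= n <oo) (supnorm (cderiven n f) / M n)%:E)%E.

End differentiation.

Section differentiation_theory.
Context (R : realType) (X : perfect_compact R).
Implicit Types (a x z : X) (f g : X -> R[i]).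

#[global] Instance dnbhs_proper a : ProperFilter a^'.
Proof.
apply: Build_ProperFilter => -[_ [[W oW <-] /= Wa WU]].
have [_ lX] := pc_perfect X.
have Xa : limit_point (pc_set X) (set_val a) by rewrite lX; exact: set_valP.
have [y [ya Xy Wy]] := Xa W (open_nbhs_nbhs (conj oW Wa)).
apply: (WU (exist _ y (mem_set Xy)) Wy).
by apply: contra_neq ya => <-.
Qed.

Definition is_cderive f g := forall a, diff_quot f a z @[z --> a^'] --> g a.

Lemma is_cderiveP f g : is_cderive f g ->
  (forall a, cderivable f a) /\ cderive f = g.
Proof.
move=> fg; split=> [a|]; first by apply/cvg_ex; exists (g a); exact: fg.
by apply/funext => a; apply: cvg_lim (fg a); exact: norm_hausdorff.
Qed.

Lemma cderivable_is_cderive f :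
  (forall a, cderivable f a) -> is_cderive f (cderive f).
Proof. by move=> df a; exact: df. Qed.

Lemma smoothP f (F : nat -> X -> R[i]) : F 0%N = f ->
  (forall n, is_cderive (F n) (F n.+1)) ->
  smooth f /\ forall n, cderiven n f = F n.
Proof.
move=> F0 FS.
have FE n : cderiven n f = F n.
  elim: n => [//|n IH]; rewrite /cderiven iterS -/(cderiven n f) IH.
  by case: (is_cderiveP (FS n)).
split; last exact: FE.
by move=> n a; rewrite FE; have [+ _] := is_cderiveP (FS n); apply.
Qed.

Lemma smooth_is_cderive f n :
  smooth f -> is_cderive (cderiven n f) (cderiven n.+1 f).
Proof. by move=> /(_ n)/cderivable_is_cderive. Qed.

Lemma is_cderive_cst (c : R[i]) : is_cderive (cst c) 0.
Proof.
move=> a; rewrite (_ : (fun z => _) = cst 0); first exact: cvg_cst.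
by apply/funext => z; rewrite /diff_quot subrr mul0r.
Qed.

Lemma is_cderiveD f g f' g' :
  is_cderive f f' -> is_cderive g g' -> is_cderive (f + g) (f' + g').
Proof.
move=> ff gg a.
rewrite (_ : (fun z => _) = diff_quot f a \+ diff_quot g a).
  exact: (cvgD (ff a) (gg a)).
by apply/funext => z; rewrite /diff_quot !fctE opprD addrACA mulrDl.
Qed.

Lemma is_cderiveZ (c : R[i]) f f' :
  is_cderive f f' -> is_cderive (c *: f) (c *: f').
Proof.
move=> ff a.
rewrite (_ : (fun z => _) = cst c \* diff_quot f a).
  exact: (@cvgM _ _ _ _ _ _ c (f' a) (cvg_cst c) (ff a)).
apply/funext => z; rewrite /diff_quot.
rewrite -[(c *: f) z]/(c * f z) -[(c *: f) a]/(c * f a) -mulrBr -mulrA.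
reflexivity.
Qed.

Lemma is_cderive_cvg f f' a : is_cderive f f' -> f z @[z --> a^'] --> f a.
Proof.
move=> ff.
have va : set_val z @[z --> a] --> set_val a by exact: initial_continuous.
have va' : set_val z @[z --> a^'] --> set_val a.
  by apply: cvg_trans va; apply: cvg_app; exact: cvg_within.
have : diff_quot f a z * (set_val z - set_val a) + f a @[z --> a^'] -->
    f' a * (set_val a - set_val a) + f a.
  apply: cvgD; last exact: cvg_cst.
  apply: cvgM; first exact: ff.
  by apply: cvgB; [exact: va'|exact: cvg_cst].
rewrite subrr mulr0 add0r; apply: cvg_trans.
apply: near_eq_cvg; near=> z.
rewrite /diff_quot divfK ?subrK// subr_eq0.
have : z != a by near: z; exact: nbhs_dnbhs_neq.
by apply: contra_neq; exact: val_inj.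
Unshelve. all: by end_near. Qed.

Lemma is_cderiveM f g f' g' : is_cderive f f' -> is_cderive g g' ->
  is_cderive (f * g) (f' * g + f * g').
Proof.
move=> ff gg a.
rewrite (_ : (fun z => _) =
  (diff_quot f a \* g) \+ (cst (f a) \* diff_quot g a)).
  apply: cvgD; first by apply: cvgM (ff a) (is_cderive_cvg (a:=a) gg).
  exact: (@cvgM _ _ _ _ _ _ (f a) (g' a) (cvg_cst _) (gg a)).
have E (u v w x d : R[i]) :
    (u * v - w * x) / d = (u - w) / d * v + w * ((v - x) / d).
  rewrite mulrAC mulrA -mulrDl; congr (_ / _).
  by rewrite mulrBl mulrBr addrA subrK.
by apply/funext => z; exact: E.
Qed.

Lemma is_cderive0 : is_cderive 0 0.
Proof. exact: (is_cderive_cst 0). Qed.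

Lemma is_cderiveMn f f' n : is_cderive f f' -> is_cderive (f *+ n) (f' *+ n).
Proof.
move=> ff; elim: n => [|n IH]; first by rewrite !mulr0n; exact: is_cderive0.
by rewrite !mulrS; exact: is_cderiveD.
Qed.

Lemma is_cderive_sum n (F G : nat -> X -> R[i]) :
  (forall k, (k < n)%N -> is_cderive (F k) (G k)) ->
  is_cderive (\sum_(k < n) F k) (\sum_(k < n) G k).
Proof.
elim: n => [|n IH] FG; first by rewrite !big_ord0; exact: is_cderive0.
rewrite !big_ord_recr /=; apply: is_cderiveD; last exact: FG.
by apply: IH => k kn; apply: FG; exact: ltnW.
Qed.

Lemma smooth_cst (c : R[i]) :
  smooth (cst c : X -> R[i]) /\
  forall n, cderiven n.+1 (cst c : X -> R[i]) = 0.
Proof.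
pose F n : X -> R[i] := if n is 0%N then cst c else 0.
have [//||sc cE] := @smoothP (cst c) F.
  by case=> [|n]; [exact: is_cderive_cst|exact: is_cderive0].
by split=> [|n]; [exact: sc|rewrite cE].
Qed.

Lemma smoothD f g : smooth f -> smooth g ->
  smooth (f + g) /\
  forall n, cderiven n (f + g) = cderiven n f + cderiven n g.
Proof.
move=> sf sg.
apply: (@smoothP _ (fun n => cderiven n f + cderiven n g)); first by [].
by move=> n; apply: is_cderiveD; exact: smooth_is_cderive.
Qed.

Lemma smoothZ (c : R[i]) f : smooth f ->
  smooth (c *: f) /\ forall n, cderiven n (c *: f) = c *: cderiven n f.
Proof.
move=> sf; apply: (@smoothP _ (fun n => c *: cderiven n f)); first by [].
by move=> n; apply: is_cderiveZ; exact: smooth_is_cderive.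
Qed.

Lemma pascal_sum (A : comPzRingType) (a b : nat -> A) n :
  \sum_(k < n.+1) (a k.+1 * b (n - k)%N + a k * b (n - k).+1) *+ 'C(n, k) =
  \sum_(k < n.+2) (a k * b (n.+1 - k)%N) *+ 'C(n.+1, k).
Proof.
transitivity (\sum_(k < n.+1) (a k.+1 * b (n - k)%N) *+ 'C(n, k) +
    \sum_(k < n.+1) (a k * b (n.+1 - k)%N) *+ 'C(n, k)).
  rewrite -big_split /=; apply: eq_bigr => k _.
  by rewrite mulrnDl subSn// -ltnS.
rewrite [RHS]big_ord_recl /= bin0 mulr1n subn0.
under [X in _ = _ + X]eq_bigr => k _ do rewrite /bump /= add1n subSS binS mulrnDr.
rewrite big_split /= [RHS]addrA [RHS]addrC; congr (_ + _).
rewrite big_ord_recl /= bin0 mulr1n subn0; congr (_ + _).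
rewrite [RHS]big_ord_recr /= bin_small// mulr0n addr0.
by apply: eq_bigr => k _; rewrite /bump /= add1n subSS.
Qed.

Lemma smoothM f g : smooth f -> smooth g ->
  smooth (f * g) /\
  forall n, cderiven n (f * g) =
    \sum_(k < n.+1) (cderiven k f * cderiven (n - k) g) *+ 'C(n, k).
Proof.
move=> sf sg; apply: (@smoothP _ (fun n =>
  \sum_(k < n.+1) (cderiven k f * cderiven (n - k) g) *+ 'C(n, k))).
  by rewrite big_ord_recl big_ord0 addr0.
move=> n; rewrite -(pascal_sum (fun k => cderiven k f) (fun k => cderiven k g)).
apply: (@is_cderive_sum n.+1
  (fun k => (cderiven k f * cderiven (n - k) g) *+ 'C(n, k))
  (fun k => (cderiven k.+1 f * cderiven (n - k) g +
     cderiven k f * cderiven (n - k).+1 g) *+ 'C(n, k))) => k _.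
by apply/is_cderiveMn/is_cderiveM; exact: smooth_is_cderive.
Qed.

Lemma ler_dist_normc (x y : R[i]) : `|normc x - normc y| <= normc (x - y).
Proof.
have H (u v : R[i]) : normc u - normc v <= normc (u - v).
  by rewrite -lecR rmorphB; exact: (lerB_dist u v).
rewrite ler_norml H andbT lerNl opprB.
have -> : normc (x - y) = normc (y - x) by rewrite -opprB normcN.
exact: H.
Qed.

Lemma normc_ge0 (x : R[i]) : 0 <= normc x.
Proof. by rewrite -lecR; exact: (normr_ge0 x). Qed.

Lemma ler_normcD (x y : R[i]) : normc (x + y) <= normc x + normc y.
Proof. by rewrite -lecR rmorphD; exact: (ler_normD x y). Qed.

Lemma is_cderive_bounded f f' :
  is_cderive f f' -> exists c, forall x, normc (f x) <= c.
Proof.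
move=> ff.
have cf : continuous (fun x : X => normc (f x)).
  move=> a; apply/(@cvgrPdist_lt _ _ _ (nbhs a)) => e e0.
  have /continuous_withinNx : f z @[z --> a^'] --> f a.
    exact: is_cderive_cvg ff.
  move=> /(@cvgrPdist_lt _ _ _ (nbhs a)) /(_ e%:C); rewrite ltcR => /(_ e0).
  apply: filterS => z; rewrite -[`|_|]/((normc _)%:C) ltcR.
  exact/le_lt_trans/ler_dist_normc.
move: cf => /(subspace_valL_continuousP' (pc_set X) 0) cf.
have [c [_ cb]] := compact_bounded (continuous_compact cf (@pc_compact _ X)).
exists (c + 1) => x; rewrite -[normc _]ger0_norm ?normc_ge0//.
apply: cb; first by rewrite ltrDl.
exists (set_val x); first exact: set_valP.
exact: (congr1 (fun h : X -> R => h x) (valLK 0 (fun x : X => normc (f x)))).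
Qed.

Lemma supnorm_ge0 f : 0 <= supnorm f.
Proof.
rewrite /supnorm; have [hs|/sup_out->//] := pselect (has_sup [set normc (f x) | x in setT]).
have [[_ [x _ _]] _] := hs.
by apply: le_trans (normc_ge0 (f x)) _; apply: sup_upper_bound => //; exists x.
Qed.

Lemma supnorm_le f c : 0 <= c -> (forall x, normc (f x) <= c) ->
  supnorm f <= c.
Proof.
move=> c0 fc; have [[x]|nX] := pselect (inhabited X).
  apply: ge_sup; first by exists (normc (f x)), x.
  by move=> r [y _ <-]; exact: fc.
rewrite /supnorm (_ : [set _ | _ in _] = set0) ?sup0//.
by apply/seteqP; split=> // r [x _ _]; case: nX; split.
Qed.

Lemma normc_le_supnorm f x n :
  smooth f -> normc (cderiven n f x) <= supnorm (cderiven n f).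
Proof.
move=> /(@smooth_is_cderive _ n)/is_cderive_bounded [c fc].
by apply: ub_le_sup; [exists c => r [y _ <-]; exact: fc|exists x].
Qed.

End differentiation_theory.

Section dales_davie.
Context (R : realType) (X : perfect_compact R) (M : weight_sequence R).
Implicit Types f g : X -> R[i].

Definition dales_davie_pred : {pred X -> R[i]} :=
  [pred f : X -> R[i] | `[< smooth f /\ (dnorm M f < +oo)%E >]].

Lemma dales_davieP f :
  reflect (smooth f /\ (dnorm M f < +oo)%E) (f \in dales_davie_pred).
Proof. exact: asboolP. Qed.

Let term_ge0 f n : 0 <= supnorm (cderiven n f) / M n.
Proof. by rewrite divr_ge0 ?supnorm_ge0// ltW// weight_gt0. Qed.

Lemma dnorm_ge0 f : (0 <= dnorm M f)%E.
Proof. by apply: nneseries_ge0 => n _ _; rewrite lee_fin. Qed.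

Lemma dnorm_le_fin f (c : R) :
  (forall N, \sum_(0 <= n < N) supnorm (cderiven n f) / M n <= c) ->
  (dnorm M f <= c%:E)%E.
Proof.
move=> fc; apply: lime_le.
  by apply: is_cvg_nneseries => n _ _; rewrite lee_fin.
by apply: nearW => N; rewrite sumEFin lee_fin.
Qed.

Lemma partial_sum_le_dnorm f N : (dnorm M f < +oo)%E ->
  \sum_(0 <= n < N) supnorm (cderiven n f) / M n <= fine (dnorm M f).
Proof.
move=> foo; rewrite -lee_fin fineK ?ge0_fin_numE ?dnorm_ge0// -sumEFin.
by apply: nneseries_lim_ge => n _ _; rewrite lee_fin.
Qed.

Lemma dnormD f g : smooth f -> smooth g ->
  (dnorm M (f + g)%R <= dnorm M f + dnorm M g)%E.
Proof.
move=> sf sg; rewrite /dnorm -nneseriesD; first last.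
- by move=> n _ _; rewrite lee_fin.
- by move=> n _ _; rewrite lee_fin.
apply: lee_nneseries => [n _ _|n _]; first by rewrite lee_fin.
rewrite -EFinD lee_fin -mulrDl ler_pM2r ?invr_gt0 ?weight_gt0//.
have [_ ->] := smoothD sf sg.
apply: supnorm_le => [|x]; first by rewrite addr_ge0 ?supnorm_ge0.
by apply: le_trans (ler_normcD _ _) _; rewrite lerD ?normc_le_supnorm.
Qed.

Lemma dnormZ_le (c : R[i]) f : smooth f ->
  (dnorm M (c *: f) <= (normc c)%:E * dnorm M f)%E.
Proof.
move=> sf; rewrite /dnorm -nneseriesZl; last first.
  by move=> n _; rewrite lee_fin.
apply: lee_nneseries => [n _ _|n _]; first by rewrite lee_fin.
rewrite -EFinM lee_fin mulrA ler_pM2r ?invr_gt0 ?weight_gt0//.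
have [_ ->] := smoothZ c sf.
apply: supnorm_le => [|x]; first by rewrite mulr_ge0 ?supnorm_ge0 ?normc_ge0.
rewrite -[(c *: _) x]/(c * _ x) normcM.
by rewrite ler_wpM2l ?normc_ge0 ?normc_le_supnorm.
Qed.

Lemma dnormZ (c : R[i]) f : smooth f ->
  dnorm M (c *: f) = ((normc c)%:E * dnorm M f)%E.
Proof.
move=> sf; apply/eqP; rewrite eq_le dnormZ_le//=.
have [->|c0] := eqVneq c 0; first by rewrite normc0 mul0e dnorm_ge0.
have nc0 : 0 < normc c.
  by rewrite lt_neqAle normc_ge0 andbT eq_sym; apply: contra_neq c0 => /eq0_normc.
have [scf _] := smoothZ c sf.
have := dnormZ_le c^-1 scf; rewrite scalerA mulVf// scale1r normcV => h.
by rewrite muleC -lee_pdivlMr// muleC.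
Qed.

Lemma cauchy_sum (a b : nat -> R) N :
  (forall n, 0 <= a n) -> (forall n, 0 <= b n) ->
  \sum_(0 <= n < N) \sum_(k < n.+1) a k * b (n - k)%N <=
  (\sum_(0 <= n < N) a n) * (\sum_(0 <= n < N) b n).
Proof.
move=> a0 b0; rewrite big_mkord.
have -> : \sum_(n < N) \sum_(k < n.+1) a k * b (n - k)%N =
    \sum_(k < N) a k * \sum_(0 <= j < N - k) b j.
  elim: N => [|N IH]; first by rewrite !big_ord0.
  rewrite big_ord_recr /= IH [in LHS]big_ord_recr [in RHS]big_ord_recr /=.
  rewrite addrA subnn subSnn big_nat1; congr (_ + _).
  rewrite -big_split /=; apply: eq_bigr => k _.
  by rewrite subSn 1?ltnW// big_nat_recr //= mulrDr.
rewrite big_mkord mulr_suml; apply: ler_sum => k _.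
rewrite ler_wpM2l// (big_cat_nat _ (leq_subr k N))//= lerDl.
by rewrite sumr_ge0.
Qed.

Lemma dales_davie_subring : GRing.subring_closed dales_davie_pred.
Proof.
split.
- apply/dales_davieP; have [s1 s1E] := @smooth_cst _ X 1.
  split=> //; apply: (@le_lt_trans _ _ 1%:E); last exact: ltry.
  apply: dnorm_le_fin => -[|N]; first by rewrite big_geq.
  rewrite big_nat_recl// big1 ?addr0 => [|n _]; last first.
    apply/eqP; rewrite mulf_eq0; apply/orP; left.
    rewrite eq_le supnorm_ge0 andbT; apply: supnorm_le => // x.
    by rewrite s1E normc0.
  rewrite weight0 divr1; apply: supnorm_le => // x.
  by rewrite normc1.
- move=> f g /dales_davieP[sf foo] /dales_davieP[sg goo].
  have [sNg _] := smoothZ (-1) sg; rewrite scaleN1r in sNg.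
  apply/dales_davieP; split; first by have [] := smoothD sf sNg.
  apply: le_lt_trans (dnormD sf sNg) _; apply: lte_add_pinfty => //.
  rewrite -scaleN1r dnormZ//; apply: lte_mul_pinfty => //.
  by rewrite lee_fin normc_ge0.
- move=> f g /dales_davieP[sf foo] /dales_davieP[sg goo].
  have [sfg fgE] := smoothM sf sg; apply/dales_davieP; split=> //.
  apply: (@le_lt_trans _ _ (fine (dnorm M f) * fine (dnorm M g))%:E);
    last exact: ltry.
  apply: dnorm_le_fin => N.
  pose a n := supnorm (cderiven n f) / M n.
  pose b n := supnorm (cderiven n g) / M n.
  have a0 n : 0 <= a n by exact: term_ge0.
  have b0 n : 0 <= b n by exact: term_ge0.
  apply: (@le_trans _ _ (\sum_(0 <= n < N) \sum_(k < n.+1) a k * b (n - k)%N)).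
    apply: ler_sum => n _; rewrite ler_pdivrMr ?weight_gt0//.
    apply: supnorm_le => [|x].
      apply: mulr_ge0; last exact/ltW/weight_gt0.
      by apply: sumr_ge0 => k _; exact: mulr_ge0.
    rewrite fgE fct_sumE mulr_suml.
    apply: (@le_trans _ _ (\sum_(k < n.+1)
      normc (((cderiven k f * cderiven (n - k) g) *+ 'C(n, k)) x))).
      elim/big_ind2 : _ => [|u u' v v' uu vv|//]; first by rewrite normc0.
      by apply: le_trans (ler_normcD _ _) _; exact: lerD.
    apply: ler_sum => k _; have kn : (k <= n)%N by rewrite -ltnS.
    have funMn (h : X -> R[i]) m : (h *+ m) x = h x *+ m.
      by elim: m => [//|m IH]; rewrite !mulrS -IH.
    rewrite funMn normcMn -[(_ * _) x]/(_ x * _ x) normcM -mulr_natr.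
    have Mk := weight_gt0 M k; have Mnk := weight_gt0 M (n - k).
    apply: (@le_trans _ _ (a k * M k * (b (n - k)%N * M (n - k)%N) *
        (M n / (M (n - k)%N * M k)))).
      rewrite /a /b !divfK ?gt_eqF//; apply: ler_pM => //.
      - by rewrite mulr_ge0 ?normc_ge0.
      - by rewrite ler_pM ?normc_ge0 ?normc_le_supnorm.
      - by have := weight_binomial M (n - k) k; rewrite subnKC.
    rewrite le_eqVlt; apply/orP; left; apply/eqP.
    by field; rewrite !gt_eqF.
  apply: le_trans (cauchy_sum _ a0 b0) _.
  apply: ler_pM; rewrite ?sumr_ge0//; exact: partial_sum_le_dnorm.
Qed.

End dales_davie.

Arguments dales_davie_pred {R} X M.

Record dales_davie (R : realType) (X : perfect_compact R)
    (M : weight_sequence R) := DalesDavie {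
  dd_fun :> X -> R[i];
  dd_funP : dd_fun \in dales_davie_pred X M }.

Section dales_davie_algebra.
Context (R : realType) (X : perfect_compact R) (M : weight_sequence R).
Local Notation D := (dales_davie X M).

HB.instance Definition _ := [isSub for @dd_fun R X M].
HB.instance Definition _ := [Choice of D by <:].
HB.instance Definition _ :=
  GRing.SubChoice_isSubComPzRing.Build _ _ D (dales_davie_subring X M).

Let dd_submod : GRing.subsemimod_closed (dales_davie_pred X M).
Proof.
have [D1 DB DM] := @dales_davie_subring R X M.
split; last first.
  move=> c f /dales_davieP[sf foo]; apply/dales_davieP.
  split; first by have [] := smoothZ c sf.
  by rewrite dnormZ// lte_mul_pinfty// ?lee_fin ?normc_ge0 ?dnorm_ge0.
have D0 : 0 \in dales_davie_pred X M by rewrite -(subrr 1); exact: DB.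
split=> // f g Df Dg; rewrite -[g]opprK; apply: (DB) => //.
by rewrite -sub0r; exact: DB.
Qed.

HB.instance Definition _ := GRing.SubZmodule_isSubLmodule.Build _ _ _ D dd_submod.

(* The norm of a module over R[i] is R[i]-valued, whence the embedding. *)
Definition dd_norm (f : D) : R[i] := (fine (dnorm M f))%:C.

Let dnorm_fin (f : D) : (fine (dnorm M f))%:E = dnorm M f.
Proof.
by have /dales_davieP[_ foo] := dd_funP f; rewrite fineK ?ge0_fin_numE ?dnorm_ge0.
Qed.

Let dd_normD (f g : D) : dd_norm (f + g) <= dd_norm f + dd_norm g.
Proof.
have /dales_davieP[sf _] := dd_funP f; have /dales_davieP[sg _] := dd_funP g.
rewrite /dd_norm -rmorphD lecR -lee_fin EFinD !dnorm_fin.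
exact: (dnormD M sf sg).
Qed.

Let dd_normZ (c : R[i]) (f : D) : dd_norm (c *: f) = `|c| * dd_norm f.
Proof.
have /dales_davieP[sf _] := dd_funP f.
rewrite /dd_norm -[`|c|]/((normc c)%:C) -rmorphM; congr (_ %:C).
by apply: EFin_inj; rewrite EFinM !dnorm_fin; exact: (dnormZ M c sf).
Qed.

Let dd_norm0_eq0 (f : D) : dd_norm f = 0 -> f = 0.
Proof.
have /dales_davieP[sf foo] := dd_funP f => /(@complexI R) f0.
apply: val_inj; apply/funext => x; apply: eq0_normc; apply/eqP.
rewrite eq_le normc_ge0 andbT -f0.
apply: le_trans (@normc_le_supnorm _ _ _ x 0 sf) _.
have := partial_sum_le_dnorm 1 foo.
by rewrite big_nat1 weight0 divr1.
Qed.

HB.instance Definition _ :=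
  Lmodule_isNormed.Build R[i] D dd_normD dd_normZ dd_norm0_eq0.

Lemma dd_normE (f : D) : `|f| = (fine (dnorm M f))%:C.
Proof. by []. Qed.

End dales_davie_algebra.

(* The completeness axiom of the library's [completeType], as a predicate. *)
Definition complete_space (T : puniformType) : Prop :=
  forall F : set_system T, ProperFilter F -> cauchy F -> cvg F.

Definition good_set (R : realType) (X : perfect_compact R) : Prop :=
  forall M : weight_sequence R, complete_space (dales_davie X M).

Definition nonanalytic (R : realType) (M : weight_sequence R) : Prop :=
  (n`!%:R / M n) `^ n%:R^-1 @[n --> \oo] --> (0 : R).

(* Characters are unital, hence nonzero. *)
Definition character (R : realType) (X : perfect_compact R)
    (M : weight_sequence R) (chi : {linear dales_davie X M -> R[i]}) : Prop :=
  GRing.monoid_morphism chi.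

Definition natural (R : realType) (X : perfect_compact R)
    (M : weight_sequence R) : Prop :=
  forall chi : {linear dales_davie X M -> R[i]}, character chi ->
    exists x : X, forall f : dales_davie X M, chi f = f x.

Definition good_algebra (R : realType) (X : perfect_compact R)
    (M : weight_sequence R) : Prop :=
  [/\ good_set X, nonanalytic M & natural X M].

Definition analytic (R : realType) (X : perfect_compact R)
    (phi : X -> R[i]) : Prop :=
  smooth phi /\
  has_ubound
    [set (supnorm (cderiven k phi) / k`!%:R) `^ k%:R^-1 | k in [set k | (0 < k)%N]].

Definition compact_operator (K : numFieldType) (V W : normedModType K)
    (T : {linear V -> W}) : Prop :=
  forall B : set V, bounded_set B -> precompact (T @` B).

(* Main.v *)
From HB Require Import structures.
Require Import Defs.
From mathcomp Require Import all_boot all_order all_algebra.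
From mathcomp Require Import complex ring lra.
From mathcomp Require Import all_classical all_reals all_analysis.

Set Implicit Arguments.
Unset Strict Implicit.
Unset Printing Implicit Defensive.
Import Order.TTheory GRing.Theory Num.Theory.
Import numFieldNormedType.Exports.
Import ComplexField.Normc.

Local Open Scope classical_set_scope.
Local Open Scope ring_scope.
Local Open Scope complex_scope.

(** Write $|g|$ for the supremum norm. The proof has two halves: an estimate
    that damps the high derivatives of $f$, and an equicontinuity argument that
    controls the finitely many low ones.

    The estimate. By induction on $n$, the identity
    $(f \circ \phi)^{(n+1)} = ((f' \circ \phi) \phi')^{(n)}$ and the Leibniz
    rule give a majorant form of the formula of Faa di Bruno: if the polynomial
    $p$ satisfies $|\phi^{(j)}| \le j! p_j$ for $1 \le j \le n$, then
    $$|(f \circ \phi)^{(n)}| \le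
        \sum_{k \le n} |f^{(k)}| \frac{n!}{k!} [t^n] p(t)^k$$
    (comp_derivative_le). The supermultiplicativity of the weights gives
    $\frac{n! M_k}{k! M_n} \le \frac{(n-k)!}{M_{n-k}}$, and non-analyticity
    bounds the right-hand side by $K e^{n-k}$ for any prescribed $e > 0$.
    Summing over $n$, the coefficient of $|f^{(k)}| / M_k$ in the norm of
    $f \circ \phi$ is at most $K (p(e)/e)^k$. The analyticity of $\phi$ permits
    $p_0 = 0$, $p_1 = |\phi'|$ and $p_j = C^j$ otherwise, so that $p(e)/e$
    tends to $|\phi'| < 1$ as $e \to 0$. Hence, for some $r < 1$,
    $$\|f \circ \phi\|_D \le K \sum_k r^k |f^{(k)}| / M_k$$
    (comp_geometric_bound).

    Compactness. As $r^k \to 0$, the norm of $f \circ \phi$ is small as soon as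
    $\|f\|_D$ is bounded and finitely many $|f^{(k)}|$ are small. The set $Y$
    need not be rectifiably connected, so a bound on $|f^{(k+1)}|$ does not
    make the functions $f^{(k)}$ equicontinuous by itself. Completeness of
    $D(Y,M)$ does: the difference quotients of $f^{(k)}$ at a point $z$ are
    seminorms on a Banach space, bounded for each $f$ because $f^{(k)}$ is
    differentiable at $z$, so the uniform boundedness principle provides a
    constant $A$ with
    $|f^{(k)}(w) - f^{(k)}(z)| \le A \|f\|_D |w - z|$
    (dd_pointwise_lipschitz). Along an ultrafilter on a bounded set, the values
    $f^{(k)}(z)$ converge for every $z$; by equicontinuity and the compactness
    of $Y$ they converge uniformly (ultra_derivative_cauchy). Therefore every
    ultrafilter on the image of a bounded set is Cauchy, and the completeness
    of $D(X,M)$ turns this into relative compactness (precompact_ultra). *)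

(** * Majorant polynomials *)

Section majorant_polynomials.
Context (R : realType).
Implicit Types p : {poly R}.

Lemma coef_exp_ge0 p k n : (forall i, 0 <= p`_i) -> 0 <= (p ^+ k)`_n.
Proof.
move=> p0; elim: k n => [|k IH] n; first by rewrite expr0 coef1 ler0n.
by rewrite exprS coefM sumr_ge0// => i _; rewrite mulr_ge0.
Qed.

(** The coefficient of $t^n$ in $(p^{k+1})' = (k+1) p^k p'$: the recursion that
    the majorants of the derivatives of a composite function obey. *)
Lemma coef_exp_deriv p k n :
  \sum_(i < n.+1) (p ^+ k)`_i * p`_(n - i).+1 *+ (n - i).+1 *+ k.+1 =
  (p ^+ k.+1)`_n.+1 *+ n.+1.
Proof.
rewrite -coef_deriv deriv_exp/= coefMn [p^`() * _]mulrC coefM -sumrMnl.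
by apply: eq_bigr => i _; rewrite coef_deriv mulrnAr.
Qed.

Lemma sum_coef_le_horner p (x : R) N :
  0 <= x -> (forall i, 0 <= p`_i) -> \sum_(n < N) p`_n * x ^+ n <= p.[x].
Proof.
move=> x0 p0; rewrite (@horner_coef_wide _ (maxn N (size p)))// ?leq_maxr//.
rewrite -!(big_mkord xpredT (fun n => p`_n * x ^+ n)).
rewrite [leRHS](@big_cat_nat _ _ _ N) ?leq_maxl//= lerDl sumr_ge0// => i _.
by rewrite mulr_ge0 ?exprn_ge0.
Qed.

End majorant_polynomials.

(** * Growth of the weights *)

Section weights.
Context (R : realType) (M : weight_sequence R).

(** The ratio $n!/M_n$ is eventually below $e^n$; the constant absorbs the
    finitely many remaining indices. *)
Lemma nonanalytic_geometric (e : R) : nonanalytic M -> 0 < e ->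
  exists2 K, 0 < K & forall n, n`!%:R / M n <= K * e ^+ n.
Proof.
move=> naM e0.
have [n0 _ n0P] : \forall n \near \oo, (n`!%:R / M n) `^ n%:R^-1 < e.
  have /cvgrPdist_lt/(_ e e0) := naM.
  by apply: filterS => n; rewrite sub0r normrN ger0_norm// powR_ge0.
have t0 n : 0 <= n`!%:R / M n by rewrite divr_ge0// ltW// weight_gt0.
exists (1 + \sum_(n < n0.+1) (n`!%:R / M n) / e ^+ n).
  by rewrite ltr_wpDr// sumr_ge0// => n _; rewrite divr_ge0// exprn_ge0// ltW.
move=> n; have [nn0|nn0] := ltnP n n0.+1.
  rewrite -ler_pdivrMr ?exprn_gt0// (bigD1 (Ordinal nn0))//=.
  rewrite addrCA lerDl addr_ge0// sumr_ge0// => i _.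
  by rewrite divr_ge0// exprn_ge0// ltW.
apply: (@le_trans _ _ (e ^+ n)); last first.
  rewrite ler_peMl ?exprn_ge0 ?(ltW e0)// lerDl sumr_ge0// => i _.
  by rewrite divr_ge0// exprn_ge0// ltW.
have n_gt0 : (0 < n)%N by exact: leq_trans nn0.
have := n0P n (ltnW nn0) => /= /ltW.
rewrite -(ler_pXn2r n_gt0) ?nnegrE ?powR_ge0 ?(ltW e0)//.
rewrite -[X in X <= _ -> _]powR_mulrn ?powR_ge0// -powRrM.
by rewrite mulVf ?pnatr_eq0 -?lt0n// powRr1.
Qed.

(** The defining inequality of a weight sequence, read as a comparison of
    $M_k/M_{m+k}$ with $1/M_m$: this is how the bounds on $m!/M_m$ enter. *)
Lemma weight_ratio k m :
  (m + k)`!%:R * M k / (k`!%:R * M (m + k)%N) <= m`!%:R / M m :> R.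
Proof.
have Mk := weight_gt0 M k; have Mm := weight_gt0 M m.
have Mmk := weight_gt0 M (m + k).
have fk : 0 < k`!%:R :> R by rewrite ltr0n fact_gt0.
have fm : 0 < m`!%:R :> R by rewrite ltr0n fact_gt0.
have := weight_binomial M m k; rewrite addnC.
have -> : 'C(m + k, k)%:R = (m + k)`!%:R / (k`!%:R * m`!%:R) :> R.
  have := bin_fact (leq_addl m k); rewrite addnK => <-.
  by rewrite !natrM mulfK// mulf_neq0 ?gt_eqF.
rewrite ler_pdivrMr ?mulr_gt0// mulrAC ler_pdivlMr ?mulr_gt0// => h.
rewrite ler_pdivrMr ?mulr_gt0// mulrAC ler_pdivlMr//.
by move: h; lra.
Qed.

End weights.

(** * Derivatives of a composite function *)

Section linear_approximation.
Context (R : realType) (X : perfect_compact R).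
Implicit Types (a x z : X) (f g : X -> R[i]).

Lemma normr_normc (w : R[i]) : `|w| = (normc w)%:C.
Proof. by []. Qed.

Lemma complex_gt0 (e : R[i]) : 0 < e -> exists2 r : R, 0 < r & e = r%:C.
Proof. by case: e => r s; rewrite ltcE /= => /andP[/eqP -> r0]; exists r. Qed.

Lemma nbhs_subtypeP a (P : set X) :
  nbhs a P <->
  exists2 d : R, 0 < d & forall z, normc (set_val z - set_val a) < d -> P z.
Proof.
split=> [|[d d0 dP]].
  rewrite nbhsE => -[U [[W oW <-] /= Wa] WP].
  have := open_nbhs_nbhs (conj oW Wa).
  move=> /nbhs_ballP[e /= /complex_gt0[d d0 ->] dW].
  exists d => // z zd; apply/WP/dW.
  by rewrite -ball_normE/= distrC normr_normc ltcR.
have va : set_val z @[z --> a] --> set_val a by exact: initial_continuous.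
have := @cvgr_dist_lt _ _ _ _ _ _ _ va d%:C; rewrite ltcR => /(_ _ d0).
apply: filterS => z /=; rewrite distrC normr_normc ltcR; exact: dP.
Qed.

(** Clearing the denominator makes the case $z = a$ harmless, which the chain
    rule needs: $\phi$ may take the value $\phi(a)$ arbitrarily close to $a$,
    where the difference quotient of the outer function is meaningless. *)
Lemma is_cderive_approxP f f' : is_cderive f f' <->
  forall a (e : R), 0 < e -> exists2 d : R, 0 < d &
    forall z, normc (set_val z - set_val a) < d ->
      normc (f z - f a - f' a * (set_val z - set_val a)) <=
        e * normc (set_val z - set_val a).
Proof.
split=> ff a.
  move=> e e0; have /cvgrPdist_lt/(_ e%:C) := ff a.
  rewrite ltcR => /(_ e0)/nbhs_subtypeP[d d0 dP]; exists d => // z zd.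
  have [->|za] := eqVneq z a; first by rewrite !subrr mulr0 subr0 normc0 mulr0.
  have za0 : set_val z - set_val a != 0.
    by rewrite subr_eq0; apply: contra_neq za; exact: val_inj.
  have := dP z zd za; rewrite normr_normc ltcR => /ltW.
  rewrite -[f z - f a](divfK za0) -/(diff_quot f a z) -mulrBl normcM.
  rewrite -[diff_quot f a z - _]opprB normcN.
  by apply: ler_wpM2r; exact: normc_ge0.
apply/cvgrPdist_le => e /complex_gt0[r r0 ->].
have [d d0 dP] := ff a r r0.
apply/nbhs_subtypeP; exists d => // z zd za.
have za0 : set_val z - set_val a != 0.
  by rewrite subr_eq0; apply: contra_neq za; exact: val_inj.
have nz0 : 0 < normc (set_val z - set_val a).
  rewrite lt_neqAle normc_ge0 andbT eq_sym.
  by apply: contra_neq za0 => /eq0_normc.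
rewrite normr_normc lecR -(ler_pM2r nz0) -normcM mulrBl divfK//.
by rewrite -normcN opprB; exact: dP.
Qed.

End linear_approximation.

Section composition.
Context (R : realType) (X Y : perfect_compact R) (phi : X -> Y).
Local Notation vphi := (fun x => set_val (phi x) : R[i]).

Lemma is_cderive_comp (f f' : Y -> R[i]) (phi' : X -> R[i]) :
  is_cderive f f' -> is_cderive vphi phi' ->
  is_cderive (f \o phi) ((f' \o phi) * phi').
Proof.
move=> /is_cderive_approxP ff /is_cderive_approxP pp.
apply/is_cderive_approxP => a e e0.
set p := normc (phi' a); set q := normc (f' (phi a)).
have p0 : 0 <= p by exact: normc_ge0.
have q0 : 0 <= q by exact: normc_ge0.
have e1_gt0 : 0 < e / (2 * (p + 1)) by rewrite divr_gt0// mulr_gt0// ltr_wpDl.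
have e2_gt0 : 0 < Num.min 1 (e / (2 * (q + 1))).
  by rewrite lt_min ltr01 divr_gt0// mulr_gt0// ltr_wpDl.
have [d1 d1_gt0 d1P] := ff (phi a) _ e1_gt0.
have [d2 d2_gt0 d2P] := pp a _ e2_gt0.
have p1 : 0 < p + 1 by rewrite ltr_wpDl.
have q1 : 0 < q + 1 by rewrite ltr_wpDl.
exists (Num.min d2 (d1 / (p + 1))); first by rewrite lt_min d2_gt0 divr_gt0.
move=> z; rewrite lt_min => /andP[zd2]; rewrite ltr_pdivlMr// => zd1.
set t := normc (set_val z - set_val a) in zd1 *.
have t0 : 0 <= t by exact: normc_ge0.
have := d2P z zd2; set u := set_val (phi z) - set_val (phi a).
set v := u - _ => vt.
have uE : u = v + phi' a * (set_val z - set_val a) by rewrite subrK.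
have v1 : normc v <= t.
  by apply: le_trans vt _; rewrite ler_piMl// ge_min lexx.
have v2 : normc v <= e / (2 * (q + 1)) * t.
  by apply: le_trans vt _; rewrite ler_wpM2r// ge_min lexx orbT.
have ut : normc u <= (p + 1) * t.
  rewrite uE (le_trans (ler_normcD _ _))// normcM -/p -/t.
  by rewrite mulrDl mul1r addrC lerD2l.
have ud1 : normc u < d1 by apply: le_lt_trans ut _; rewrite mulrC.
have := d1P (phi z) ud1; rewrite -/u => w1.
rewrite (_ : _ - _ = (f (phi z) - f (phi a) - f' (phi a) * u) +
    f' (phi a) * v); last first.
  by rewrite uE -[((f' \o phi) * phi') a]/(f' (phi a) * phi' a) /=; ring.
apply: (le_trans (ler_normcD _ _)); rewrite normcM -/q.
have h1 : e / (2 * (p + 1)) * normc u <= e / 2 * t.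
  rewrite (_ : e / 2 * t = e / (2 * (p + 1)) * ((p + 1) * t)).
    by rewrite ler_wpM2l// ltW.
  by field; rewrite gt_eqF.
have h2 : q * normc v <= e / 2 * t.
  rewrite (_ : e / 2 * t = (q + 1) * (e / (2 * (q + 1)) * t)).
    by rewrite ler_pM ?normc_ge0// lerDl.
  by field; rewrite gt_eqF.
have : e * t = e / 2 * t + e / 2 * t by field.
by move=> ->; exact: lerD (le_trans w1 h1) h2.
Qed.

(** A class of functions that contains the composites and is stable under
    derivation, by the chain and product rules; smoothness of the composites
    follows without an explicit formula for their derivatives. *)
Inductive composite_sum : (X -> R[i]) -> Prop :=
| composite_prod f g : smooth f -> smooth g -> composite_sum ((f \o phi) * g)
| composite_add h1 h2 : composite_sum h1 -> composite_sum h2 ->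
    composite_sum (h1 + h2).

Lemma smooth_cderive (Z : perfect_compact R) (f : Z -> R[i]) :
  smooth f -> smooth (cderive f).
Proof. by move=> sf n a; have := sf n.+1 a; rewrite /cderiven iterSr. Qed.

Lemma composite_sum_derive h : smooth vphi -> composite_sum h ->
  is_cderive h (cderive h) /\ composite_sum (cderive h).
Proof.
move=> sphi hS.
suff [h' [hh' h'S]] : exists h', is_cderive h h' /\ composite_sum h'.
  by have [_ ->] := is_cderiveP hh'.
elim: hS => [f g sf sg|h1 h2 _ [h1' [d1 S1]] _ [h2' [d2 S2]]].
  have df := @smooth_is_cderive _ _ f 0 sf.
  have dg := @smooth_is_cderive _ _ g 0 sg.
  have dphi := @smooth_is_cderive _ _ _ 0 sphi.
  exists (((cderive f \o phi) * cderive vphi) * g + (f \o phi) * cderive g).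
  split; first exact: is_cderiveM (is_cderive_comp df dphi) dg.
  apply: composite_add; last exact: composite_prod (smooth_cderive sg).
  rewrite -mulrA; apply: composite_prod (smooth_cderive sf) _.
  by have [] := smoothM (smooth_cderive sphi) sg.
by exists (h1' + h2'); split; [exact: is_cderiveD|exact: composite_add].
Qed.

Lemma smooth_comp f : smooth vphi -> smooth f ->
  smooth (f \o phi) /\ cderive (f \o phi) = (cderive f \o phi) * cderive vphi.
Proof.
move=> sphi sf.
have df := @smooth_is_cderive _ _ f 0 sf.
have dphi := @smooth_is_cderive _ _ _ 0 sphi.
split; last by have [_ ->] := is_cderiveP (is_cderive_comp df dphi).
have fS : composite_sum (f \o phi).
  have [s1 _] := @smooth_cst _ X 1.
  by have := composite_prod sf s1; rewrite mulr1.
have iterS n : composite_sum (cderiven n (f \o phi)).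
  elim: n => [//|n IH]; rewrite /cderiven iterS -/(cderiven n _).
  by have [] := composite_sum_derive sphi IH.
have := @smoothP _ _ (f \o phi) (fun n => cderiven n (f \o phi)) erefl
  (fun n => proj1 (composite_sum_derive sphi (iterS n))).
by case.
Qed.

Lemma normc_sum (I : Type) (s : seq I) (F : I -> R[i]) :
  normc (\sum_(i <- s) F i) <= \sum_(i <- s) normc (F i).
Proof.
elim/big_ind2 : _ => [|u u' v v' uu vv|//]; first by rewrite normc0.
by apply: le_trans (ler_normcD _ _) _; exact: lerD.
Qed.

Lemma funMn (h : X -> R[i]) m x : (h *+ m) x = h x *+ m.
Proof. by elim: m => [//|m IH]; rewrite !mulrS -IH. Qed.

(** Majorant form of the formula of Faa di Bruno. For $n+1$, apply the Leibniz
    rule to $(f' \circ \phi) \phi'$ and the induction hypothesis to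
    $f' \circ \phi$: the factor of $|f^{(k+1)}|$ becomes a multiple of the
    coefficient of $t^n$ in $p^k p'$, which coef_exp_deriv evaluates. *)
Lemma comp_derivative_le (p : {poly R}) N : smooth vphi ->
  (forall i, 0 <= p`_i) ->
  (forall j, (0 < j <= N)%N -> supnorm (cderiven j vphi) <= j`!%:R * p`_j) ->
  forall n f x, (n <= N)%N -> smooth f ->
  normc (cderiven n (f \o phi) x) <=
    \sum_(k < n.+1) supnorm (cderiven k f) * (n`!%:R / k`!%:R * (p ^+ k)`_n).
Proof.
move=> sphi p0 pphi.
have sn0 (Z : perfect_compact R) (g : Z -> R[i]) : 0 <= supnorm g.
  exact: supnorm_ge0.
have t0 k n : 0 <= n`!%:R / k`!%:R * (p ^+ k)`_n.
  by rewrite mulr_ge0 ?coef_exp_ge0// divr_ge0.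
elim/ltn_ind => -[|n] IH f x nN sf.
  rewrite big_ord_recl big_ord0 addr0 expr0 coef1 eqxx !mulr1 divr1 mulr1.
  exact: (normc_le_supnorm (phi x) 0 sf).
have [_ dcomp] := smooth_comp sphi sf.
have sf' := smooth_cderive sf.
have [sf'phi _] := smooth_comp sphi sf'.
have [_ leibniz] := smoothM sf'phi (smooth_cderive sphi).
rewrite {1}/cderiven iterSr -/(cderiven n _) dcomp leibniz fct_sumE.
apply: le_trans (normc_sum _ _) _.
pose u k := supnorm (cderiven k.+1 f).
have u0 k : 0 <= u k by exact: sn0.
apply: (@le_trans _ _ (\sum_(i < n.+1) \sum_(k < n.+1)
    u k * (n`!%:R / k`!%:R * ((p ^+ k)`_i * p`_(n - i).+1 *+ (n - i).+1)))).
  apply: ler_sum => i _; have iN : (i <= n)%N by rewrite -ltnS.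
  rewrite funMn normcMn -[(_ * _) x]/(_ x * _ x) normcM -[leLHS]mulr_natl.
  have h1 := IH i (ltn_ord i) _ x (leq_trans iN (ltnW nN)) sf'.
  have h2 : normc (cderiven (n - i) (cderive vphi) x) <=
      (n - i).+1`!%:R * p`_(n - i).+1.
    apply: le_trans (normc_le_supnorm _ _ (smooth_cderive sphi)) _.
    have := pphi (n - i).+1; rewrite /cderiven iterSr; apply.
    by rewrite ltnS leq0n (leq_trans _ nN)// ltnS leq_subr.
  have h1' : normc (cderiven i (cderive f \o phi) x) <=
      \sum_(k < n.+1) u k * (i`!%:R / k`!%:R * (p ^+ k)`_i).
    apply: le_trans h1 _.
    pose G k := u k * (i`!%:R / k`!%:R * (p ^+ k)`_i).
    rewrite -(big_mkord xpredT G) (@big_cat_nat _ _ _ i.+1)//= big_mkord.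
    rewrite ler_wpDr ?sumr_ge0// => [k _|].
      by rewrite mulr_ge0 ?t0.
    by apply: ler_sum => k _; rewrite /G /u /cderiven iterSr.
  have := ler_wpM2l (ler0n R 'C(n, i))
    (ler_pM (normc_ge0 _) (normc_ge0 _) h1' h2).
  move=> /le_trans; apply; rewrite mulr_suml mulr_sumr.
  apply: ler_sum => k _; rewrite le_eqVlt; apply/orP; left; apply/eqP.
  have -> : n`!%:R = 'C(n, i)%:R * (i`!%:R * (n - i)`!%:R) :> R.
    by rewrite -!natrM bin_fact.
  have -> : (n - i).+1`!%:R = (n - i).+1%:R * (n - i)`!%:R :> R.
    by rewrite -natrM -factS.
  rewrite -[(p ^+ k)`_i * _ *+ _]mulr_natl.
  move: ('C(n, i)%:R : R) (i`!%:R : R) ((n - i)`!%:R : R) ((n - i).+1%:R : R)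
    ((p ^+ k)`_i) (p`_(n - i).+1) (k`!%:R^-1 : R) (u k) => c a b d r s t w.
  by ring.
rewrite exchange_big /= [leRHS]big_ord_recl.
apply: ler_wpDl; first by rewrite mulr_ge0 ?t0.
apply: ler_sum => k _; rewrite lift0 -/(u k) -!mulr_sumr.
rewrite le_eqVlt; apply/orP; left; apply/eqP; congr (_ * _).
set S := \sum_(i < n.+1) _.
have E : k.+1%:R * S = n.+1%:R * (p ^+ k.+1)`_n.+1.
  by rewrite !mulr_natl -coef_exp_deriv sumrMnl.
have k0 : k.+1%:R != 0 :> R by rewrite pnatr_eq0.
apply: (mulfI k0); rewrite mulrCA E !factS !natrM invfM.
rewrite mulrCA [in RHS]mulrA [n.+1%:R * _ * _]mulrCA -!mulrA.
by rewrite mulVKf.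
Qed.

End composition.

(** * The norm of a composite function *)

Section geometric_bound.
Context (R : realType) (X Y : perfect_compact R) (M : weight_sequence R).
Context (phi : X -> Y).
Local Notation vphi := (fun x => set_val (phi x) : R[i]).

(** The factor of $|f^{(k)}|/M_k$ is at most
    $K e^{-k} \sum_n [t^n] p(t)^k e^n \le K (p(e)/e)^k$, by weight_ratio and
    the bound on $n!/M_n$. Adding the nonnegative terms with $k > n$ to the
    double sum makes it rectangular, so that the order of summation can be
    exchanged. *)
Lemma comp_partial_sum_le (p : {poly R}) (e r K : R) N : smooth vphi ->
  (forall i, 0 <= p`_i) ->
  (forall j, (0 < j <= N)%N -> supnorm (cderiven j vphi) <= j`!%:R * p`_j) ->
  0 < e -> p.[e] <= r * e -> 0 <= K ->
  (forall n, n`!%:R / M n <= K * e ^+ n) ->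
  forall f : Y -> R[i], smooth f ->
  \sum_(n < N) supnorm (cderiven n (f \o phi)) / M n <=
    K * \sum_(k < N) r ^+ k * (supnorm (cderiven k f) / M k).
Proof.
move=> sphi p0 pphi e0 pr K0 KP f sf.
have M0 n : 0 < M n by exact: weight_gt0.
pose v k := supnorm (cderiven k f) / M k.
have v0 k : 0 <= v k by rewrite divr_ge0 ?supnorm_ge0// ltW.
apply: (@le_trans _ _ (\sum_(n < N) \sum_(k < N)
    v k * (K / e ^+ k * ((p ^+ k)`_n * e ^+ n)))).
  apply: ler_sum => n _; rewrite ler_pdivrMr//.
  have c0 k m : 0 <= v k * (K / e ^+ k * ((p ^+ k)`_m * e ^+ m)).
    have ek j : 0 <= e ^+ j by rewrite exprn_ge0// ltW.
    by rewrite mulr_ge0// mulr_ge0 ?divr_ge0 ?mulr_ge0 ?coef_exp_ge0.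
  apply: supnorm_le => [|x].
    by apply: mulr_ge0; [apply: sumr_ge0 => k _; exact: c0|exact: ltW].
  apply: le_trans (comp_derivative_le sphi p0 pphi x (ltnW (ltn_ord n)) sf) _.
  pose G k := v k * (K / e ^+ k * ((p ^+ k)`_n * e ^+ n)).
  rewrite -(big_mkord xpredT G) (@big_cat_nat _ _ _ n.+1)//= mulrDl.
  apply: ler_wpDr.
    by apply: mulr_ge0; [apply: sumr_ge0 => k _; exact: c0|exact: ltW].
  rewrite big_mkord mulr_suml; apply: ler_sum => k _.
  have kn : (k <= n)%N by rewrite -ltnS.
  have := weight_ratio M k (n - k); rewrite subnK// => /le_trans/(_ (KP _)).
  have -> : K * e ^+ (n - k) = K / e ^+ k * e ^+ n.
    rewrite -mulrA (_ : e ^+ n = e ^+ (n - k) * e ^+ k); last first.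
      by rewrite -exprD subnK.
    congr (_ * _).
    by rewrite mulrCA mulVf ?mulr1// expf_neq0// gt_eqF.
  move=> h.
  have w0 : 0 <= v k * (p ^+ k)`_n * M n.
    apply: mulr_ge0; last exact: ltW.
    by apply: mulr_ge0; [exact: v0|exact: coef_exp_ge0].
  have := ler_wpM2l w0 h.
  rewrite /G /v.
  have kf0 : k`!%:R != 0 :> R by rewrite pnatr_eq0 -lt0n fact_gt0.
  set L := (X in X <= _ -> _); set L' := (X in _ <= X -> _) => LL.
  rewrite (_ : supnorm _ * _ = L); last first.
    by rewrite /L /v; field; rewrite kf0 !gt_eqF.
  apply: le_trans LL _; rewrite le_eqVlt; apply/orP; left; apply/eqP.
  by rewrite /L' /v; ring.
rewrite exchange_big/= mulr_sumr; apply: ler_sum => k _.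
rewrite -/(v k) -!mulr_sumr.
have -> : K * (r ^+ k * v k) = v k * (K * r ^+ k) by ring.
apply: ler_wpM2l => //; rewrite -mulrA; apply: ler_wpM2l => //.
rewrite mulrC ler_pdivrMr ?exprn_gt0// -exprMn.
apply: le_trans (sum_coef_le_horner N (ltW e0) _) _.
  by move=> i; exact: coef_exp_ge0.
have pe0 : 0 <= p.[e].
  rewrite horner_coef sumr_ge0// => i _; apply: mulr_ge0 => //.
  by apply: exprn_ge0; exact: ltW.
by rewrite horner_exp lerXn2r// nnegrE (le_trans pe0).
Qed.

Lemma geometric_sum_le2 (x : R) n : 0 <= x -> 2 * x <= 1 ->
  \sum_(i < n) x ^+ i <= 2.
Proof.
move=> x0 x2; set S := \sum_(i < n) _.
have := subrX1 x n; rewrite -/S => E.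
have S0 : 0 <= S by rewrite sumr_ge0// => i _; rewrite exprn_ge0.
have : 0 <= x ^+ n by rewrite exprn_ge0.
by nra.
Qed.

(** With $p = a t + \sum_{j \ge 2} (C t)^j$, where $a = |\phi'|$, the quotient
    $p(e)/e$ is at most $a + 2 C^2 e$ once $2 C e \le 1$; the choice
    $e = (1-a)/(4 C^2)$ makes it at most $(1+a)/2 < 1$. *)
Lemma comp_geometric_bound : nonanalytic M -> analytic vphi ->
  supnorm (cderive vphi) < 1 ->
  exists K r : R, [/\ 0 < K, 0 < r < 1 &
    forall (f : Y -> R[i]) N, smooth f ->
    \sum_(n < N) supnorm (cderiven n (f \o phi)) / M n <=
      K * \sum_(k < N) r ^+ k * (supnorm (cderiven k f) / M k)].
Proof.
move=> naM [sphi [C0 C0P]] phi1.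
set a := supnorm _ in phi1; have a0 : 0 <= a by exact: supnorm_ge0.
pose C := Num.max 1 C0; have C1 : 1 <= C by rewrite le_max lexx.
have CP k : (0 < k)%N -> supnorm (cderiven k vphi) <= k`!%:R * C ^+ k.
  move=> k0; have f0 : 0 < k`!%:R :> R by rewrite ltr0n fact_gt0.
  rewrite mulrC -ler_pdivrMr//.
  have t0 : 0 <= supnorm (cderiven k vphi) / k`!%:R.
    by rewrite divr_ge0 ?supnorm_ge0.
  have : (supnorm (cderiven k vphi) / k`!%:R) `^ k%:R^-1 <= C.
    by rewrite le_max; apply/orP; right; apply: C0P; exists k.
  rewrite -(ler_pXn2r k0) ?nnegrE ?powR_ge0 ?(le_trans ler01)//.
  rewrite -[X in X <= _ -> _]powR_mulrn ?powR_ge0// -powRrM.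
  by rewrite mulVf ?pnatr_eq0 -?lt0n// powRr1.
pose e := (1 - a) / (4 * C ^+ 2).
have C2 : 0 < 4 * C ^+ 2 by rewrite mulr_gt0// exprn_gt0// (lt_le_trans ltr01).
have e0 : 0 < e by rewrite divr_gt0// subr_gt0.
have eE : 4 * C ^+ 2 * e = 1 - a by rewrite mulrC divfK// gt_eqF.
have [K K0 KP] := nonanalytic_geometric naM e0.
exists K, ((1 + a) / 2); split=> //; first by apply/andP; split; lra.
move=> f N sf.
(* A truncation of the majorant series suffices for the derivatives of order
   below $N$ and avoids power series. *)
pose c j := if j is j'.+1 then if j' is 0%N then a else C ^+ j else 0.
have c0 j : 0 <= c j.
  by case: j => [|[|j]]//=; rewrite exprn_ge0// (le_trans ler01).
pose p := \poly_(j < N.+2) c j.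
apply: (@comp_partial_sum_le p e) => //; last exact: ltW.
- by move=> i; rewrite coef_poly; case: ifP.
- move=> [|[|j]]// jN; rewrite coef_poly ltnS (leq_trans jN)//.
    by rewrite (_ : 1`! = 1%N)// mul1r.
  exact: CP.
- rewrite horner_poly !big_ord_recl/= mul0r add0r expr1.
  have -> : \sum_(i < N) c (bump 0 (bump 0 i)) * e ^+ (bump 0 (bump 0 i)) =
      (C * e) ^+ 2 * \sum_(i < N) (C * e) ^+ i.
    rewrite mulr_sumr; apply: eq_bigr => i _.
    by rewrite -exprD /bump /= !add1n add2n -exprMn.
  have Ce0 : 0 <= C * e by rewrite mulr_ge0 ?(ltW e0)// (le_trans ler01).
  have Ce1 : 2 * (C * e) <= 1.
    have : C * e <= C ^+ 2 * e.
      by rewrite ler_wpM2r ?(ltW e0)// expr2 ler_peMl// (le_trans ler01).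
    by lra.
  have := ler_wpM2l (exprn_ge0 2 Ce0) (geometric_sum_le2 N Ce0 Ce1).
  have -> : (C * e) ^+ 2 * 2 = (1 - a) / 2 * e by rewrite -eE; field.
  by lra.
Qed.

End geometric_bound.

(** * The uniform boundedness principle *)

Section uniform_boundedness.
Context (R : realType) (V : normedModType R[i]).

(** The norm of a module over the complex numbers is a complex number that
    happens to be real; estimates are carried out on its real part. *)
Definition rnorm (v : V) : R := complex.Re `|v|.

Lemma rnormE v : `|v| = (rnorm v)%:C.
Proof.
rewrite /rnorm; case: `|v| (normr_ge0 v) => a b.
by rewrite lecE /= => /andP[/eqP->].
Qed.

Lemma rnorm_ge0 v : 0 <= rnorm v.
Proof. by have := normr_ge0 v; rewrite rnormE lecR. Qed.

Lemma rnormD u v : rnorm (u + v) <= rnorm u + rnorm v.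
Proof. by have := ler_normD u v; rewrite !rnormE -rmorphD lecR. Qed.

Lemma rnorm_dist u v : rnorm (u - v) = rnorm (v - u).
Proof. by rewrite /rnorm distrC. Qed.

Lemma rnormZ (c : R) v : 0 <= c -> rnorm (c%:C *: v) = c * rnorm v.
Proof.
move=> c0; have := normrZ c%:C v.
by rewrite !rnormE ger0_norm ?lecR// -rmorphM => /complexI.
Qed.

Lemma ball_rnormE (x y : V) (e : R) : ball x e%:C y <-> rnorm (x - y) < e.
Proof. by rewrite -ball_normE /= rnormE ltcR. Qed.

Lemma nested_ball_limit (x : nat -> V) (r : nat -> R) : complete_space V ->
  (forall n, r n <= 2^-1 ^+ n) ->
  (forall m n, (n <= m)%N -> rnorm (x m - x n) <= r n) ->
  exists l, forall n, rnorm (l - x n) <= r n.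
Proof.
move=> cV rn xr.
have r2 (d : R) : 0 < d -> exists n, r n < d.
  move=> d0; have : (2^-1 : R) ^+ n @[n --> \oo] --> 0.
    by apply: cvg_expr; rewrite ger0_norm// invf_lt1// ltr1n.
  move=> /cvgrPdist_lt/(_ d d0)[n _ nP]; exists n.
  have := nP n (leqnn n); rewrite /= sub0r normrN ger0_norm ?exprn_ge0//.
  exact: le_lt_trans.
have cx : cauchy (x @ \oo).
  apply: cauchy_exP => e /complex_gt0[d d0 ->].
  have [n nd] := r2 d d0.
  exists (x n), n => // m /= nm; apply/ball_rnormE.
  by rewrite rnorm_dist; exact: le_lt_trans (xr _ _ nm) nd.
have [l xl] := (cvg_ex _).1 (cV _ _ cx).
exists l => n; apply/ler_addgt0Pr => d d0.
have := @cvgr_dist_lt _ _ _ _ _ _ _ xl d%:C.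
rewrite ltcR => /(_ _ d0)[m _ /(_ (maxn m n) (leq_maxl _ _)) /=].
rewrite rnormE ltcR => h.
rewrite (_ : l - x n = (l - x (maxn m n)) + (x (maxn m n) - x n)).
  by rewrite (le_trans (rnormD _ _))// addrC lerD ?(ltW h) ?xr ?leq_maxr.
by rewrite addrA subrK.
Qed.

(** If the seminorms $p_i$ are not uniformly bounded on the unit ball, they are
    unbounded on every ball. As each of them is continuous, this gives nested
    balls such that on the $n$-th one some $p_i$ exceeds $n$; the family is
    unbounded at their common point. *)
Lemma uniform_boundedness (I : Type) (p : I -> V -> R) :
  complete_space V ->
  (forall i u v, p i (u - v) <= p i u + p i v) ->
  (forall i (c : R) v, 0 <= c -> p i (c%:C *: v) = c * p i v) ->
  (forall i, exists2 A, 0 <= A & forall v, p i v <= A * rnorm v) ->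
  (forall v, exists c, forall i, p i v <= c) ->
  exists2 A, 0 <= A & forall i v, p i v <= A * rnorm v.
Proof.
move=> cV pB pZ pc pb; apply: contrapT => npA.
have unb (A : R) : 0 <= A -> exists i v, A * rnorm v < p i v.
  move=> A0; apply: contrapT => nA; apply: npA; exists A => // i v.
  by rewrite leNgt; apply/negP => h; apply: nA; exists i, v.
pose next n (s t : V * R) := 0 < s.2 ->
  [/\ 0 < t.2, t.2 <= s.2 / 2, rnorm (t.1 - s.1) <= s.2 / 2 &
    exists i, forall y, rnorm (y - t.1) <= t.2 -> n%:R < p i y].
have /choice[f fP] (ns : nat * (V * R)) : exists t, next ns.1 ns.2 t.
  case: ns => n [x r]; have [r0|r0] := ltP 0 r; last first.
    by exists (0, 0) => /=; rewrite /next/= ltNge r0.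
  have [c xc] := pb x.
  have h0 : 0 < r / 2 by rewrite divr_gt0.
  have c1 : 0 <= n%:R + 1 + `|c| :> R by rewrite addr_ge0// addr_ge0.
  have [|i [v iv]] := unb ((n%:R + 1 + `|c|) / (r / 2)).
    by rewrite divr_ge0// ltW.
  have [A A0 Ai] := pc i.
  have v0 : 0 < rnorm v.
    rewrite lt_neqAle rnorm_ge0 andbT; apply/eqP => v0; move: iv.
    by have := Ai v; rewrite -v0 !mulr0 => /le_lt_trans h /h; rewrite ltxx.
  pose u := (r / 2 / rnorm v)%:C *: v.
  have sc0 : 0 <= r / 2 / rnorm v by rewrite ltW ?divr_gt0.
  have ru : rnorm u = r / 2 by rewrite rnormZ ?divfK ?gt_eqF.
  have pu : n%:R + 1 + `|c| < p i u.
    rewrite pZ// mulrAC ltr_pdivlMr//.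
    by rewrite -ltr_pdivrMl// mulrA [_^-1 * _]mulrC.
  have A1 : 0 < A + 1 by rewrite ltr_wpDl.
  exists (x + u, Num.min (r / 2) (A + 1)^-1); split=> /=.
  - by rewrite lt_min h0 invr_gt0.
  - by rewrite ge_min lexx.
  - by rewrite addrC addKr ru.
  exists i => y; rewrite le_min => /andP[_ yA].
  (* The family is bounded by [c] at [x], so a large value at [u] forces a large
     value at [x + u]. *)
  have h1 := pB i (x + u) x; rewrite addrC addKr in h1.
  have h2 := pB i y (y - (u + x)); rewrite opprB addrC subrK in h2.
  rewrite addrC [x + u]addrC in yA.
  have h3 : p i (y - (u + x)) <= 1.
    apply: le_trans (Ai _) _; rewrite addrC.
    apply: (@le_trans _ _ (A * (A + 1)^-1)); first exact: ler_wpM2l.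
    by rewrite ler_pdivrMr// mul1r lerDl.
  have := xc i; have := ler_norm c.
  rewrite [u + x]addrC in h2 h3.
  by lra.
pose fix s n := if n is m.+1 then f (m, s m) else (0 : V, 1 : R).
have s0 n : 0 < (s n).2.
  by elim: n => [|n IH] /=; [exact: ltr01|have [] := fP (n, s n) IH].
have sP n : [/\ 0 < (s n.+1).2, (s n.+1).2 <= (s n).2 / 2,
    rnorm ((s n.+1).1 - (s n).1) <= (s n).2 / 2 &
    exists i, forall y, rnorm (y - (s n.+1).1) <= (s n.+1).2 -> n%:R < p i y].
  exact: fP (n, s n) (s0 n).
have [||l lP] := @nested_ball_limit (fst \o s) (snd \o s) cV.
- elim=> [|n IH] /=; first by rewrite expr0.
  have [_ h _ _] := sP n; apply: le_trans h _.
  by rewrite exprS mulrC ler_pM2l ?invr_gt0.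
- move=> m n nm /=; rewrite -(subnK nm).
  move: (m - n)%N => d; elim: d n {nm} => [|d IH] n.
    by rewrite add0n subrr /rnorm normr0 ltW.
  rewrite addSn -addnS.
  have [_ h1 h2 _] := sP n; have h3 := IH n.+1.
  rewrite (_ : _ - _ =
      ((s (d + n.+1)%N).1 - (s n.+1).1) + ((s n.+1).1 - (s n).1)).
    by apply: le_trans (rnormD _ _) _; lra.
  by rewrite addrA subrK.
have [c lc] := pb l.
have [_ _ _ [i iP]] := sP (Num.truncn `|c|).+1.
have := iP l (lP _); have := lc i; have := ler_norm c.
have := truncnS_gt `|c|.
rewrite -natr1.
by lra.
Qed.

End uniform_boundedness.

(** * Equicontinuity of derivatives *)

Section modulus.
Context (R : realType).
Implicit Types w : R[i].

Lemma normc_real (c : R) : normc c%:C = `|c|.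
Proof. by rewrite /= expr0n addr0 sqrtr_sqr. Qed.

Lemma normc_gt0 w : w != 0 -> 0 < normc w.
Proof.
move=> w0; rewrite lt_neqAle normc_ge0 andbT eq_sym.
by apply: contra_neq w0 => /eq0_normc.
Qed.

Lemma normc_le_ReIm w : normc w <= `|complex.Re w| + `|complex.Im w|.
Proof.
case: w => a b /=; rewrite -[leRHS]ger0_norm ?addr_ge0// -sqrtr_sqr.
rewrite ler_wsqrtr// sqrrD !real_normK ?num_real// addrAC lerDl.
by rewrite mulrn_wge0// mulr_ge0.
Qed.

Lemma Re_le_normc w : `|complex.Re w| <= normc w.
Proof. by case: w => a b /=; rewrite -sqrtr_sqr ler_wsqrtr// lerDl sqr_ge0. Qed.

Lemma Im_le_normc w : `|complex.Im w| <= normc w.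
Proof. by case: w => a b /=; rewrite -sqrtr_sqr ler_wsqrtr// lerDr sqr_ge0. Qed.

End modulus.

Section equicontinuity.
Context (R : realType) (Y : perfect_compact R) (M : weight_sequence R).
Local Notation D := (dales_davie Y M).
Implicit Types (f g : D).

Lemma dd_smooth f : smooth f.
Proof. by have /dales_davieP[] := dd_funP f. Qed.
Arguments dd_smooth : clear implicits.

Lemma rnorm_ddE f : rnorm f = fine (dnorm M f).
Proof. by []. Qed.

Lemma cderivenB k f g :
  cderiven k (f - g : D) = cderiven k f - cderiven k g.
Proof.
have [sN NE] := smoothZ (-1) (dd_smooth g).
have [_ DE] := smoothD (dd_smooth f) sN.
have := DE k; rewrite NE !scaleN1r; exact.
Qed.

Lemma cderivenZ k (c : R[i]) f : cderiven k (c *: f : D) = c *: cderiven k f.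
Proof. by have [_ E] := smoothZ c (dd_smooth f); exact: E. Qed.

Lemma partial_sum_le_rnorm f N :
  \sum_(n < N) supnorm (cderiven n f) / M n <= rnorm f.
Proof.
have /dales_davieP[_ foo] := dd_funP f.
by have := partial_sum_le_dnorm N foo; rewrite big_mkord.
Qed.

Lemma supnorm_le_rnorm k f : supnorm (cderiven k f) <= M k * rnorm f.
Proof.
rewrite mulrC -ler_pdivrMr ?weight_gt0//.
apply: le_trans (partial_sum_le_rnorm f k.+1).
rewrite big_ord_recr /= lerDr sumr_ge0// => i _.
by rewrite divr_ge0 ?supnorm_ge0// ltW// weight_gt0.
Qed.

Lemma normc_cderiven_le k f y : normc (cderiven k f y) <= M k * rnorm f.
Proof.
apply: le_trans (supnorm_le_rnorm k f).
exact: normc_le_supnorm (dd_smooth f).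
Qed.

(** Near $z$ the quotients are close to $g'(z)$; away from $z$ the denominator
    is bounded below and $g$ is bounded. *)
Lemma diff_quot_bounded (g g' : Y -> R[i]) z : is_cderive g g' ->
  exists c, forall w, normc (diff_quot g z w) <= c.
Proof.
move=> gg'.
have [B gB] := is_cderive_bounded gg'.
have B0 : 0 <= B := le_trans (normc_ge0 _) (gB z).
have /(_ z 1 ltr01)[d d0 dP] := (is_cderive_approxP _ _).1 gg'.
exists (normc (g' z) + 1 + 2 * B / d) => w.
have c0 : 0 <= 2 * B / d by rewrite divr_ge0 ?mulr_ge0// ltW.
have [->|wz] := eqVneq w z.
  by rewrite /diff_quot !subrr mul0r normc0 !addr_ge0 ?normc_ge0.
have vwz : set_val w - set_val z != 0.
  by rewrite subr_eq0; apply: contra_neq wz; exact: val_inj.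
have nwz := normc_gt0 vwz.
rewrite /diff_quot normcM normcV ler_pdivrMr//.
have [wd|wd] := ltP (normc (set_val w - set_val z)) d.
  have := dP w wd; set h := g w - g z; set v := set_val w - set_val z => hv.
  rewrite (_ : h = (h - g' z * v) + g' z * v); last by rewrite subrK.
  apply: le_trans (ler_normcD _ _) _; rewrite normcM.
  have : 0 <= 2 * B / d * normc v by rewrite mulr_ge0// ltW.
  rewrite !mulrDl; move: hv.
  by lra.
have h1 : normc (g w - g z) <= 2 * B.
  apply: le_trans (ler_normcD _ _) _; rewrite normcN.
  by have := gB w; have := gB z; lra.
apply: le_trans h1 _.
apply: (@le_trans _ _ (2 * B / d * normc (set_val w - set_val z))).
  by rewrite mulrAC ler_pdivlMr// ler_wpM2l// mulr_ge0.
by rewrite ler_wpM2r// ?(ltW nwz)// lerDr addr_ge0// normc_ge0.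
Qed.

(** The uniform boundedness principle, applied to the seminorms
    $f \mapsto |f^{(k)}(w) - f^{(k)}(z)| / |w - z|$ indexed by $w$. *)
Lemma dd_pointwise_lipschitz k z : complete_space D ->
  exists2 A, 0 <= A & forall f w,
    normc (cderiven k f w - cderiven k f z) <=
      A * rnorm f * normc (set_val w - set_val z).
Proof.
move=> cD.
have [||||A A0 AP] :=
    @uniform_boundedness R D Y
      (fun w f => normc (diff_quot (cderiven k f) z w)) cD.
- move=> w f g; rewrite cderivenB.
  have -> : diff_quot (cderiven k f - cderiven k g) z w =
      diff_quot (cderiven k f) z w - diff_quot (cderiven k g) z w.
    rewrite /diff_quot -mulrBl; congr (_ / _).
    by rewrite -[LHS]/(cderiven k f w - cderiven k g w -
      (cderiven k f z - cderiven k g z)); ring.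
  by apply: le_trans (ler_normcD _ _) _; rewrite normcN.
- move=> w c f c0; rewrite cderivenZ /diff_quot.
  rewrite -[(c%:C *: cderiven k f) w]/(c%:C * cderiven k f w).
  rewrite -[(c%:C *: cderiven k f) z]/(c%:C * cderiven k f z).
  by rewrite -mulrBr -mulrA normcM normc_real ger0_norm.
- move=> w; exists (2 * M k / normc (set_val w - set_val z)) => [|f].
    by rewrite divr_ge0 ?normc_ge0// mulr_ge0// ltW// weight_gt0.
  rewrite /diff_quot normcM normcV mulrAC ler_wpM2r ?invr_ge0 ?normc_ge0//.
  apply: le_trans (ler_normcD _ _) _; rewrite normcN.
  have := normc_cderiven_le k f w; have := normc_cderiven_le k f z.
  by lra.
- move=> f; apply: diff_quot_bounded.
  exact: smooth_is_cderive (dd_smooth f).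
exists A => // f w; have [->|wz] := eqVneq w z.
  by rewrite !subrr normc0 mulr0.
have vwz : set_val w - set_val z != 0.
  by rewrite subr_eq0; apply: contra_neq wz; exact: val_inj.
have := AP w f; rewrite /diff_quot normcM normcV ler_pdivrMr//.
exact: normc_gt0.
Qed.

End equicontinuity.

(** * Compactness through ultrafilters *)

Section ultrafilters.

(** A filter on the closure of $A$ is moved to a filter on $A$ by enlarging each
    of its sets by each entourage. An ultrafilter finer than the latter
    converges, and its limit is a cluster point of the original filter. *)
Lemma precompact_ultra (T : puniformType) (A : set T) : complete_space T ->
  (forall G : set_system T, UltraFilter G -> G A -> cauchy G) -> precompact A.
Proof.
move=> cT uA; rewrite precompactE => F FF FA.
pose B (EP : set (T * T) * set T) :=
  [set a | A a /\ exists2 p, EP.2 p & EP.1 (p, a)].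
pose H := filter_from [set EP | entourage EP.1 /\ F EP.2] B.
have HF : ProperFilter H.
  apply: filter_from_proper.
    apply: filter_from_filter.
      by exists (setT, setT); split; [exact: entourageT|exact: filterT].
    move=> [E1 P1] [E2 P2] [/= e1 F1] [/= e2 F2].
    exists (E1 `&` E2, P1 `&` P2); first by split; exact: filterI.
    by move=> a [Aa [p [/= p1 p2] [q1 q2]]]; split; split=> //; exists p.
  move=> [E P] [/= eE FP].
  have [p [Pp Ap]] := filter_ex (filterI FP FA).
  have [a [Aa Ea]] := Ap _ (nbhs_entourage p eE).
  by exists a; split=> //; exists p => //; move/xsectionP: Ea.
have [G [GU HG]] := ultraFilterLemma HF.
have GA : G A.
  apply: HG; exists (setT, setT); last by move=> a [].
  by split; [exact: entourageT|exact: filterT].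
have [l Gl] := (cvg_ex _).1 (cT _ _ (uA _ GU GA)).
exists l; split.
  by move=> U lU; exact: filter_ex (filterI GA (Gl _ lU)).
move=> P U FP lU; move: lU; rewrite -nbhs_entourageE => -[E eE EU].
have [E' eE' E'E] := entourage_split_ex eE.
have G1 : G (xsection E' l) by apply: Gl; exact: nbhs_entourage.
have G2 : G (B (E'^-1%relation, P)).
  apply: HG; exists (E'^-1%relation, P) => //.
  by split=> //; exact: entourage_inv.
have [a [/xsectionP la [Aa [p Pp pa]]]] := filter_ex (filterI G1 G2).
exists p; split=> //; apply/EU/xsectionP/E'E.
by exists a.
Qed.

Lemma ultra_bounded_real (R : realType) (T : Type) (G : set_system T)
    (h : T -> R) c e : UltraFilter G -> G [set t | `|h t| <= c] -> 0 < e ->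
  exists l, G [set t | `|h t - l| < e].
Proof.
move=> GU Gc e0.
have [|l [_ cl]] := @segment_compact R (- c) c (h @ G) _.
  apply: filterS Gc => t /=; rewrite in_itv /= -ler_norml; exact.
exists l; have [//|nG] := in_ultra_setVsetC [set t | `|h t - l| < e] GU.
have [||x [/= [t nt <-] lx]] :=
    cl (h @` (~` [set t | `|h t - l| < e])) (ball l e).
- apply: (@filterS _ G _ (~` [set t | `|h t - l| < e])) => // t nt.
  by exists t.
- exact: nbhsx_ballx.
by exfalso; apply: nt; move: lx; rewrite -ball_normE /= distrC.
Qed.

Lemma ultra_bounded_complex (R : realType) (T : Type) (G : set_system T)
    (h : T -> R[i]) (c e : R) :
  UltraFilter G -> G [set t | normc (h t) <= c] -> 0 < e ->
  exists l, G [set t | normc (h t - l) <= e].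
Proof.
move=> GU Gc e0; have e2 : 0 < e / 2 by rewrite divr_gt0.
have [a Ga] : exists a, G [set t | `|complex.Re (h t) - a| < e / 2].
  apply: ultra_bounded_real e2; apply: filterS Gc => t.
  exact: le_trans (Re_le_normc _).
have [b Gb] : exists b, G [set t | `|complex.Im (h t) - b| < e / 2].
  apply: ultra_bounded_real e2; apply: filterS Gc => t.
  exact: le_trans (Im_le_normc _).
exists (a +i* b); apply: filterS (filterI Ga Gb) => t [/= ta tb].
apply: le_trans (normc_le_ReIm _) _.
move: ta tb; case: (h t) => x y /=; lra.
Qed.

(** Near each point $z$ of $Y$, two members of a suitable set of the ultrafilter
    are close: their values at $z$ are, and their variation around $z$ is
    controlled by dd_pointwise_lipschitz. Compactness of $Y$ leaves finitely
    many $z$ to consider. *)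
Lemma ultra_derivative_cauchy (R : realType) (Y : perfect_compact R)
    (M : weight_sequence R) (T : Type) (G : set_system T)
    (s : T -> dales_davie Y M) (b : R) k (e : R) :
  complete_space (dales_davie Y M) -> UltraFilter G ->
  G [set t | rnorm (s t) <= b] -> 0 < e ->
  exists2 U, G U &
    forall t u, U t -> U u -> supnorm (cderiven k (s t - s u)) <= e.
Proof.
move=> cD GU Gb e0.
have b0 : 0 <= b.
  by have [t] := filter_ex Gb; exact: le_trans (rnorm_ge0 _).
(* Indexing the predicate by complex numbers lets the compactness of the set
   [pc_set Y] apply directly, without a detour through the subspace topology. *)
pose P (tu : T * T) (y : R[i]) := forall w : Y, set_val w = y ->
  normc (cderiven k (s tu.1) w - cderiven k (s tu.2) w) <= e.
have : \forall tu \near filter_prod G G, pc_set Y `<=` P tu.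
  apply: ((compact_near_coveringP _).1 (@pc_compact _ Y)) => y Yy.
  pose z : Y := exist _ y (mem_set Yy).
  have e4 : 0 < e / 4 by rewrite divr_gt0.
  have [A A0 AP] := dd_pointwise_lipschitz k z cD.
  have [|l Gl] := @ultra_bounded_complex R T G
      (fun t => cderiven k (s t) z) (M k * b) (e / 4) GU _ e4.
    apply: filterS Gb => t /= tb; apply: le_trans (normc_cderiven_le _ _ _) _.
    by rewrite ler_wpM2l// ltW// weight_gt0.
  pose Q := [set t | normc (cderiven k (s t) z - l) <= e / 4 /\
    rnorm (s t) <= b].
  have GQ : G Q by apply: filterS (filterI Gl Gb).
  have Ab : 0 < 4 * (A * b + 1) by rewrite mulr_gt0// ltr_wpDl// mulr_ge0.
  exists (ball y (e / (4 * (A * b + 1)))%:C, Q `*` Q).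
    split; first by apply: nbhsx_ballx; rewrite ltcR divr_gt0.
    by exists (Q, Q).
  move=> [y' [t u]] [/= yy' [[tl tb] [ul ub]]] w wy'.
  have wz : normc (set_val w - set_val z) <= e / (4 * (A * b + 1)).
    move: yy'; rewrite -ball_normE /= distrC normr_normc ltcR -wy'; exact: ltW.
  have step v : rnorm (s v) <= b ->
      normc (cderiven k (s v) w - cderiven k (s v) z) <= e / 4.
    move=> vb; apply: le_trans (AP _ _) _.
    apply: (@le_trans _ _ ((A * b + 1) * (e / (4 * (A * b + 1))))).
      rewrite ler_pM ?normc_ge0 ?mulr_ge0 ?rnorm_ge0//.
      by apply: (@le_trans _ _ (A * b)); rewrite ?ler_wpM2l// lerDl.
    rewrite le_eqVlt; apply/orP; left; apply/eqP; field.
    by rewrite gt_eqF// ltr_wpDl// mulr_ge0.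
  have := step _ tb; have := step _ ub; move: tl ul => /=.
  set tw := cderiven k (s t) w; set tz := cderiven k (s t) z.
  set uw := cderiven k (s u) w; set uz := cderiven k (s u) z.
  move=> h1 h2 h3 h4.
  rewrite (_ : tw - uw = ((tw - tz) + (tz - l)) + ((uz - uw) + (l - uz))).
    have n1 : normc (uz - uw) <= e / 4 by rewrite -opprB normcN.
    have n2 : normc (l - uz) <= e / 4 by rewrite -opprB normcN.
    have := ler_normcD (tw - tz + (tz - l)) (uz - uw + (l - uz)).
    have := ler_normcD (tw - tz) (tz - l).
    have := ler_normcD (uz - uw) (l - uz).
    by lra.
  by ring.
move=> [[U1 U2] [/= GU1 GU2] UP]; exists (U1 `&` U2); first exact: filterI.
move=> t u [t1 _] [_ u2]; apply: supnorm_le => [|w]; first exact: ltW.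
rewrite cderivenB; apply: (UP (t, u)) => //.
exact: set_valP.
Qed.

End ultrafilters.

(** * The composition operator *)

Section composition_operator.
Context (R : realType) (X Y : perfect_compact R) (M : weight_sequence R).
Context (phi : X -> Y).
Context (phiD : forall f : dales_davie Y M,
  (f : Y -> R[i]) \o phi \in dales_davie_pred X M).

Definition comp_op (f : dales_davie Y M) : dales_davie X M :=
  DalesDavie (phiD f).

Lemma comp_op_linear : linear comp_op.
Proof. by move=> c f g; exact: val_inj. Qed.

HB.instance Definition _ :=
  GRing.isLinear.Build R[i] (dales_davie Y M) (dales_davie X M) _ comp_op
    comp_op_linear.

Lemma comp_op_monoid_morphism : GRing.monoid_morphism comp_op.
Proof. by split=> [|f g]; exact: val_inj. Qed.

End composition_operator.

Section compactness.
Context (R : realType).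

Lemma rnorm_le (X : perfect_compact R) (M : weight_sequence R)
    (f : dales_davie X M) (c : R) :
  (forall N, \sum_(n < N) supnorm (cderiven n f) / M n <= c) -> rnorm f <= c.
Proof.
move=> fc; rewrite rnorm_ddE.
have h : (dnorm M f <= c%:E)%E.
  by apply: dnorm_le_fin => N; rewrite big_mkord; exact: fc.
rewrite -lee_fin fineK// ge0_fin_numE ?Defs.dnorm_ge0//.
exact: le_lt_trans h (ltry c).
Qed.

(** The tail beyond $n_0$ is at most $r^{n_0} b$; the head has finitely many
    terms. *)
Lemma weighted_sum_small (M : weight_sequence R) (r b e : R) :
  0 < r < 1 -> 0 < e -> 0 <= b ->
  exists n0 (d : R), 0 < d /\ forall a : nat -> R,
    (forall k, 0 <= a k) ->
    (forall N, \sum_(k < N) a k / M k <= b) ->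
    (forall k, (k < n0)%N -> a k <= d) ->
    forall N, \sum_(k < N) r ^+ k * (a k / M k) <= e.
Proof.
move=> /andP[r0 r1] e0 b0.
have M0 n : 0 < M n by exact: weight_gt0.
have b1 : 0 < b + 1 by rewrite ltr_wpDl.
have e2 : 0 < e / 2 / (b + 1) by rewrite !divr_gt0.
have [n0 n0P] : exists n, r ^+ n * b <= e / 2.
  have : r ^+ n @[n --> \oo] --> 0 by apply: cvg_expr; rewrite ger0_norm// ltW.
  move=> /cvgrPdist_lt/(_ _ e2)[n _ nP]; exists n.
  have := nP n (leqnn n).
  rewrite /= sub0r normrN ger0_norm ?exprn_ge0 ?(ltW r0)//.
  rewrite ltr_pdivlMr// => /ltW; apply: le_trans.
  by rewrite ler_wpM2l ?exprn_ge0 ?(ltW r0)// lerDl.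
pose S := \sum_(k < n0) (M k)^-1.
have S0 : 0 <= S by rewrite sumr_ge0// => k _; rewrite invr_ge0 ltW.
have S1 : 0 < S + 1 by rewrite ltr_wpDl.
exists n0, (e / 2 / (S + 1)); split; first by rewrite !divr_gt0.
move=> a a0 ab ad N.
have v0 k : 0 <= a k / M k by rewrite divr_ge0// ltW.
have rv0 k : 0 <= r ^+ k * (a k / M k) by rewrite mulr_ge0// exprn_ge0// ltW.
apply: (@le_trans _ _ (\sum_(k < n0 + N) r ^+ k * (a k / M k))).
  rewrite -!(big_mkord xpredT (fun k => r ^+ k * (a k / M k))).
  by rewrite [leRHS](@big_cat_nat _ _ _ N) ?leq_addl//= lerDl sumr_ge0.
rewrite big_split_ord/= (splitr e); apply: lerD.
  apply: (@le_trans _ _ (e / 2 / (S + 1) * S)).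
    rewrite /S mulr_sumr; apply: ler_sum => k _.
    apply: (@le_trans _ _ (a k / M k)).
      by rewrite ler_piMl// exprn_ile1 ?ltW.
    by rewrite ler_wpM2r ?invr_ge0 ?(ltW (M0 k))// ad.
  by rewrite mulrAC ler_pdivrMr// ler_wpM2l ?lerDl// ltW// divr_gt0.
apply: le_trans n0P.
apply: (@le_trans _ _ (\sum_(i < N) r ^+ n0 * (a (n0 + i)%N / M (n0 + i)%N))).
  apply: ler_sum => i _; rewrite ler_wpM2r// exprD.
  rewrite ler_piMr ?exprn_ge0 ?(ltW r0)//.
  by rewrite exprn_ile1 ?ltW.
rewrite -mulr_sumr ler_wpM2l ?exprn_ge0 ?(ltW r0)//.
apply: le_trans (ab (n0 + N)%N).
by rewrite big_split_ord/= lerDr sumr_ge0.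
Qed.

Lemma bounded_set_rnorm (V : normedModType R[i]) (B : set V) :
  bounded_set B -> exists2 b, 0 <= b & forall v, B v -> rnorm v <= b.
Proof.
move=> [c [_ cB]].
exists `|complex.Re (c + 1)| => // v Bv.
have := cB (c + 1) _ v Bv; rewrite ltrDl ltr01 => /(_ isT).
rewrite /= rnormE; case: (c + 1) => x y; rewrite lecE /= => /andP[_].
by move=> h; apply: le_trans h (ler_norm _).
Qed.

(** The difference of two functions of the bounded set has bounded norm, so by
    weighted_sum_small its image is small once finitely many of its derivatives
    are, which happens along an ultrafilter. *)
Lemma compact_of_geometric_bound (X Y : perfect_compact R) (M : weight_sequence R)
    (T : {linear dales_davie Y M -> dales_davie X M}) (K r : R) :
  complete_space (dales_davie X M) -> complete_space (dales_davie Y M) ->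
  0 < K -> 0 < r < 1 ->
  (forall f N, \sum_(n < N) supnorm (cderiven n (T f)) / M n <=
      K * \sum_(k < N) r ^+ k * (supnorm (cderiven k f) / M k)) ->
  compact_operator T.
Proof.
move=> cX cY K0 r01 TK B /bounded_set_rnorm[b b0 bB].
apply: precompact_ultra => // G GU GTB.
(* [s] chooses preimages in [B], so that the ultrafilter need not be pulled
   back along [T]. *)
have /choice[s sP] (g : dales_davie X M) :
    exists f, (T @` B) g -> B f /\ T f = g.
  have [[f Bf fg]|nB] := pselect ((T @` B) g); first by exists f.
  by exists 0.
have Gb : G [set g | rnorm (s g) <= b].
  by apply: filterS GTB => g /sP[Bg _]; exact: bB.
apply: cauchy_exP => e' /complex_gt0[e e0 ->].
have e2K : 0 < e / 2 / K by rewrite !divr_gt0.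
have bb : 0 <= b + b by rewrite addr_ge0.
have [n0 [d [d0 dP]]] := weighted_sum_small M r01 e2K bb.
have [U GU' UP] : exists2 U, G U & forall t u, U t -> U u ->
    forall k, (k < n0)%N -> supnorm (cderiven k (s t - s u)) <= d.
  elim: n0 {dP} => [|n [U GU' UP]]; first by exists setT => //; exact: filterT.
  have [W GW WP] := ultra_derivative_cauchy n cY GU Gb d0.
  exists (U `&` W); first exact: filterI.
  move=> t u [Ut Wt] [Uu Wu] k; rewrite ltnS leq_eqVlt => /predU1P[->|kn].
    exact: WP.
  exact: UP.
have GUB : G (U `&` T @` B) by exact: filterI.
have [g0 [Ug0 Bg0]] := filter_ex GUB.
exists g0; apply: filterS GUB => g [Ug Bg]; apply/ball_rnormE.
have [Bf0 <-] := sP _ Bg0; have [Bf <-] := sP _ Bg.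
apply: (@le_lt_trans _ _ (e / 2)); last first.
  by rewrite ltr_pdivrMr// ltr_pMr// ltr1n.
rewrite -raddfB; apply: rnorm_le => N.
apply: le_trans (TK _ _) _; rewrite mulrC -ler_pdivlMr//.
apply: (dP (fun k => supnorm (cderiven k (s g0 - s g)))) => [k|m|k kn].
- exact: supnorm_ge0.
- apply: le_trans (partial_sum_le_rnorm _ _) _.
  apply: le_trans (rnormD _ _) _.
  have -> : rnorm (- s g) = rnorm (s g) by rewrite /rnorm normrN.
  by apply: lerD; exact: bB.
- exact: UP.
Qed.

End compactness.

Theorem theorem5 (R : realType) (X Y : perfect_compact R)
    (M : weight_sequence R) (phi : X -> Y) :
  good_algebra X M -> good_algebra Y M ->
  analytic (fun x => set_val (phi x)) ->
  supnorm (cderive (fun x => set_val (phi x))) < 1 ->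
  exists T : {linear dales_davie Y M -> dales_davie X M},
    [/\ GRing.monoid_morphism T,
        (forall (f : dales_davie Y M) (x : X), T f x = f (phi x)) &
        compact_operator T].
Proof.
move=> [gX naM _] [gY _ _] aphi phi1.
have [K [r [K0 r01 KP]]] := comp_geometric_bound naM aphi phi1.
have fphi_le (f : dales_davie Y M) N :
    \sum_(n < N) supnorm (cderiven n ((f : Y -> R[i]) \o phi)) / M n <=
    K * \sum_(k < N) r ^+ k * (supnorm (cderiven k f) / M k).
  exact: KP (@dd_smooth _ _ _ f).
have phiD (f : dales_davie Y M) :
    (f : Y -> R[i]) \o phi \in dales_davie_pred X M.
  apply/dales_davieP; split.
    by have [] := smooth_comp aphi.1 (@dd_smooth _ _ _ f).
  apply: (@le_lt_trans _ _ (K * rnorm f)%:E); last exact: ltry.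
  apply: dnorm_le_fin => N; rewrite big_mkord.
  apply: le_trans (fphi_le f N) _; apply: ler_wpM2l; first exact: ltW.
  apply: le_trans (partial_sum_le_rnorm f N); apply: ler_sum => k _.
  have /andP[r0 r1] := r01.
  rewrite ler_piMl ?exprn_ile1 ?(ltW r0) ?(ltW r1)//.
  by rewrite divr_ge0 ?supnorm_ge0// ltW// weight_gt0.
exists (comp_op phiD : {linear _ -> _}); split.
- exact: comp_op_monoid_morphism.
- by [].
- exact: (@compact_of_geometric_bound _ _ _ _ (comp_op phiD) K r
    (gX M) (gY M) K0 r01).
Qed.
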